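(* Let $F\colon\mathbb{R}^d\to\mathbb{R}$ be bounded from below by $F^*>-\infty$ and $(L_0,L_1)$-smooth with $L_0\ge 0$, $L_1>0$, and let the stochastic gradient oracle $\nabla f(\cdot,\xi)$ be unbiased with variance bounded by $\sigma^2$, $\sigma\ge 0$. Set $\beta_t := 1-t^{-1/2}$ and $\eta_t := \frac{t^{-3/4}}{12L_1}$ for $t\ge 1$. Then the iterates $(x_t)$ of NSGD-M with starting point $x_1\in\mathbb{R}^d$, stepsizes $\eta_t$ and moving average parameters $\beta_t$ satisfy $$\frac1T\sum_{t=1}^T \mathbb{E}\big[\|\nabla F(x_t)\|\big]\;\le\;\widetilde{\mathcal O}\!\left(\frac{L_1\Delta_1+\sigma+\frac{L_0}{L_1}}{T^{1/4}}\right),$$ where $\Delta_1 := F(x_1)-F^*$. Here $\widetilde{\mathcal O}$ hides absolute constants and factors polylogarithmic in $T$; that is, there are absolute constants $C,k>0$ (independent of $d,F,F^*,L_0,L_1,\sigma,x_1$, the oracle and $T$) such that for all $T\ge 1$ the left-hand side is at most $C(1+\log T)^k\,\frac{L_1\Delta_1+\sigma+L_0/L_1}{T^{1/4}}$.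
   Context: $d\ge1$ is an integer and $\|\cdot\|$ is the Euclidean norm. $(L_0,L_1)$-smoothness: for $L_0,L_1\ge0$, a differentiable $F\colon\mathbb{R}^d\to\mathbb{R}$ is $(L_0,L_1)$-smooth if for all $x,y\in\mathbb{R}^d$ and all $c>0$ with $L_1\|x-y\|\le c$, $$\|\nabla F(x)-\nabla F(y)\|\le\big(A_0(c)L_0+A_1(c)L_1\|\nabla F(x)\|\big)\|x-y\|,$$ where $A_0(c):=1+e^c-\frac{e^c-1}{c}$ and $A_1(c):=\frac{e^c-1}{c}$. Bounded variance oracle: $\xi$ is a random vector and, for every $x\in\mathbb{R}^d$, $\mathbb{E}[\nabla f(x,\xi)]=\nabla F(x)$ and $\mathbb{E}[\|\nabla f(x,\xi)-\nabla F(x)\|^2]\le\sigma^2$. NSGD-M (Normalized SGD with Momentum): given $x_1\in\mathbb{R}^d$, stepsizes $\eta_t>0$ and parameters $\beta_t\in[0,1)$, set $m_0:=0$ and for $t=1,2,\dots$: sample $\xi_t$ independently from the distribution of $\xi$, and put $g_t:=\nabla f(x_t,\xi_t)$, $m_t:=\beta_t m_{t-1}+(1-\beta_t)g_t$, $x_{t+1}:=x_t-\frac{\eta_t}{\|m_t\|}m_t$. *)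

(* Defs.v *)
(* MathComp-Analysis: everything is stated over an abstract R : realType. *)
From HB Require Import structures.
From mathcomp Require Export all_boot all_order all_algebra.
From mathcomp Require Export all_classical all_reals all_analysis.

Set Implicit Arguments.
Unset Strict Implicit.
Unset Printing Implicit Defensive.

Export Order.TTheory GRing.Theory Num.Theory.
Export numFieldNormedType.Exports.

Local Open Scope classical_set_scope.
Local Open Scope ring_scope.

(* The library norm `|x| on row vectors is the sup norm, whence this one. *)
Definition enorm (R : realType) (d : nat) (x : 'rV[R]_d) : R :=
  Num.sqrt (\sum_(i < d) x 0 i ^+ 2).

(* Vector of partial derivatives; meaningful where F is differentiable.
   Differentiability does not depend on the choice of the norm on R^d. *)
Definition grad (R : realType) (d : nat) (F : 'rV[R]_d -> R) (x : 'rV[R]_d) :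
    'rV[R]_d :=
  \row_(i < d) 'D_(delta_mx 0 i) F x.

Definition A0 (R : realType) (c : R) : R := 1 + expR c - (expR c - 1) / c.

Definition A1 (R : realType) (c : R) : R := (expR c - 1) / c.

Definition L0L1_smooth (R : realType) (d : nat) (L0 L1 : R)
    (F : 'rV[R]_d -> R) : Prop :=
  (forall x, differentiable F x) /\
  (forall (x y : 'rV[R]_d) (c : R), 0 < c -> L1 * enorm (x - y) <= c ->
     enorm (grad F x - grad F y) <=
       (A0 c * L0 + A1 c * L1 * enorm (grad F x)) * enorm (x - y)).

(* Joint measurability of the stochastic gradient (x, z) |-> G x z, with R^d
   carrying its product (= Borel) sigma-algebra. The library puts the latter on
   d.-tuple R, hence the change of type of the first variable. *)
Definition measurable_oracle (R : realType) (d : nat) (dX : measure_display)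
    (Xi : measurableType dX) (G : 'rV[R]_d -> Xi -> 'rV[R]_d) : Prop :=
  forall i : 'I_d,
    measurable_fun [set: d.-tuple R * Xi]
      (fun p : d.-tuple R * Xi => G (\row_j tnth p.1 j) p.2 0 i).

(* The expectation is taken coordinatewise. Each one is a Lebesgue integral in
   \bar R; its being finite forces the coordinate to be integrable. *)
Definition unbiased_oracle (R : realType) (d : nat) (dO dX : measure_display)
    (Omega : measurableType dO) (Xi : measurableType dX)
    (P : probability Omega R) (xi : {RV P >-> Xi})
    (G : 'rV[R]_d -> Xi -> 'rV[R]_d) (F : 'rV[R]_d -> R) : Prop :=
  forall (x : 'rV[R]_d) (i : 'I_d),
    'E_P[(fun w => G x (xi w) 0 i)%R]%E = (grad F x 0 i)%:E.

Definition bounded_variance_oracle (R : realType) (d : nat)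
    (dO dX : measure_display)
    (Omega : measurableType dO) (Xi : measurableType dX)
    (P : probability Omega R) (xi : {RV P >-> Xi})
    (G : 'rV[R]_d -> Xi -> 'rV[R]_d) (F : 'rV[R]_d -> R) (sigma : R) : Prop :=
  forall x : 'rV[R]_d,
    ('E_P[(fun w => enorm (G x (xi w) - grad F x) ^+ 2)%R] <= (sigma ^+ 2)%:E)%E.

(* Mutual independence of the family (X i) for i in I. *)
Definition mutually_independent (R : realType) (dO dX : measure_display)
    (Omega : measurableType dO) (Xi : measurableType dX)
    (P : probability Omega R) (I : set nat) (X : nat -> {RV P >-> Xi}) : Prop :=
  forall (s : seq nat) (A : nat -> set Xi),
    uniq s -> [set` s] `<=` I ->
    (forall i, i \in s -> measurable (A i)) ->
    P (\bigcap_(i in [set` s]) (X i @^-1` A i)) =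
    (\prod_(i <- s) P (X i @^-1` A i))%E.

Definition same_law (R : realType) (dO dX : measure_display)
    (Omega : measurableType dO) (Xi : measurableType dX)
    (P : probability Omega R) (X Y : {RV P >-> Xi}) : Prop :=
  forall A : set Xi, measurable A -> distribution P X A = distribution P Y A.

(* Normalized SGD with momentum along one sample path z 1, z 2, ...
   The state after t steps is the pair (x_{t+1}, m_t). Since 0^-1 = 0, a step
   with m_t = 0 leaves the iterate unchanged. *)
Fixpoint nsgdm_state (R : realType) (d : nat) (Xi : Type)
    (G : 'rV[R]_d -> Xi -> 'rV[R]_d) (eta beta : nat -> R) (x1 : 'rV[R]_d)
    (z : nat -> Xi) (t : nat) : 'rV[R]_d * 'rV[R]_d :=
  if t is s.+1 then
    let: (x, m) := nsgdm_state G eta beta x1 z s in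
    let g := G x (z t) in
    let m' := beta t *: m + (1 - beta t) *: g in
    (x - (eta t / enorm m') *: m', m')
  else (x1, 0).

(* x_t, for t >= 1. *)
Definition nsgdm (R : realType) (d : nat) (Xi : Type)
    (G : 'rV[R]_d -> Xi -> 'rV[R]_d) (eta beta : nat -> R) (x1 : 'rV[R]_d)
    (z : nat -> Xi) (t : nat) : 'rV[R]_d :=
  (nsgdm_state G eta beta x1 z t.-1).1.

(* Main.v *)
From HB Require Import structures.
Require Import Defs.
From mathcomp Require Import measurable_realfun.
From mathcomp Require Import ring lra.

(** The proof rests on splitting the momentum into gradient, noise and drift.

    Write [m_t = grad F (x_t) + n_t + r_t].  The noise part [n_t] is the
    exponential average of the oracle errors [g_t - grad F (x_t)] with the same
    weights as the momentum, and the drift [r_t] is what remains: it only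
    records that the momentum averages gradients taken at past iterates.  The
    two parts need different arguments.

    The drift is controlled along every sample path.  Each step has length at
    most [eta_t], so one step multiplies the drift by [beta_t] and adds at most
    [eta_t (2 L0 + 2 L1 |grad F (x_t)|)].  The term proportional to the
    gradient may be absorbed into the descent of [F], because [eta_t] carries
    the factor [1 / (12 L1)].  The potential [F (x_{t+1}) + w_t |r'_t|], with
    [w_t = t^(-1/4) / (6 L1)] and [r'_t] the drift measured against the gradient
    at the next iterate, makes this exact: it loses at least
    [eta_t |grad F (x_t)| / 2] and gains at most
    [2 eta_t |n_t| + L0 / (24 L1^2 t)] per step ([potential_decrease]).
    Summing gives [pathwise_bound], in which [|n_t|] is the only random term on
    the right-hand side.

    The noise is controlled in mean square.  Given the past, the next oracle
    error has mean zero and is fresh, so that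
    [E |n_{t+1}|^2 <= beta^2 E |n_t|^2 + (1 - beta)^2 sigma^2]
    ([noise_moment_step]), whence [E |n_t|^2 <= 2 t^(-1/2) sigma^2].  Conditional
    expectations are avoided: the triple (iterate, momentum, averaged noise) is
    a Markov chain driven by the samples, its state at time [t] is independent of
    the sample at time [t + 1], and Tonelli's theorem for the product law
    ([integral_chain]) reduces the one-step estimate to a fixed state, where it
    is the expansion of a square.

    With [eta_t = t^(-3/4) / (12 L1)] every error term is of order [1 / t], so
    the sums are harmonic and produce one logarithm; dividing by [T eta_T], which
    is of order [T^(1/4) / L1], gives the rate with [C = 24] and [k = 1]. *)

Set Implicit Arguments.
Unset Strict Implicit.
Unset Printing Implicit Defensive.

Local Open Scope classical_set_scope.
Local Open Scope ring_scope.

(** * Euclidean geometry and the descent inequality *)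

Section euclidean.
Context {R : realType} {d : nat}.
Implicit Types (u v w : 'rV[R]_d) (a : R).

Definition dot u v : R := \sum_(i < d) u 0 i * v 0 i.

Lemma dotC u v : dot u v = dot v u.
Proof. by apply: eq_bigr => i _; rewrite mulrC. Qed.

Lemma dotDl u v w : dot (u + v) w = dot u w + dot v w.
Proof.
by rewrite /dot -big_split/=; apply: eq_bigr => i _; rewrite mxE mulrDl.
Qed.

Lemma dotZl a u v : dot (a *: u) v = a * dot u v.
Proof.
by rewrite /dot big_distrr/=; apply: eq_bigr => i _; rewrite mxE mulrA.
Qed.

Lemma dotNl u v : dot (- u) v = - dot u v.
Proof. by rewrite -scaleN1r dotZl mulN1r. Qed.

Lemma dotDr u v w : dot u (v + w) = dot u v + dot u w.
Proof. by rewrite dotC dotDl !(dotC u). Qed.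

Lemma dotZr a u v : dot u (a *: v) = a * dot u v.
Proof. by rewrite dotC dotZl dotC. Qed.

Lemma dotNr u v : dot u (- v) = - dot u v.
Proof. by rewrite dotC dotNl dotC. Qed.

Lemma enorm_ge0 u : 0 <= enorm u. Proof. exact: sqrtr_ge0. Qed.

Lemma sqr_enorm u : enorm u ^+ 2 = dot u u.
Proof.
by rewrite sqr_sqrtr ?sumr_ge0// => i _; rewrite sqr_ge0.
Qed.

Lemma enormZ a u : enorm (a *: u) = `|a| * enorm u.
Proof.
apply/eqP; rewrite -(@eqrXn2 _ 2)// ?enorm_ge0 ?mulr_ge0 ?enorm_ge0//.
by rewrite exprMn real_normK ?num_real// !sqr_enorm dotZl dotZr mulrA -expr2.
Qed.

Lemma enorm0 : enorm (0 : 'rV[R]_d) = 0.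
Proof. by rewrite -(scale0r 0) enormZ normr0 mul0r. Qed.

Lemma enormN u : enorm (- u) = enorm u.
Proof. by rewrite -scaleN1r enormZ normrN1 mul1r. Qed.

Lemma enorm0_eq0 u : enorm u = 0 -> u = 0.
Proof.
move=> u0; have : \sum_(i < d) u 0 i ^+ 2 = 0.
  by have := sqr_enorm u; rewrite u0 expr0n/= => /esym.
move/eqP; rewrite psumr_eq0 => [/allP z|i _]; last exact: sqr_ge0.
apply/rowP => i; rewrite mxE; apply/eqP.
by have := z i (mem_index_enum _); rewrite sqrf_eq0.
Qed.

Lemma dot_le_enorm u v : dot u v <= enorm u * enorm v.
Proof.
have [/enorm0_eq0 ->|u0] := eqVneq (enorm u) 0.
  by rewrite -(scale0r 0) dotZl mul0r mulr_ge0 ?enorm_ge0.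
have [/enorm0_eq0 ->|v0] := eqVneq (enorm v) 0.
  by rewrite -(scale0r 0) dotZr mul0r mulr_ge0 ?enorm_ge0.
have a0 : 0 < enorm u by rewrite lt_neqAle eq_sym u0 enorm_ge0.
have b0 : 0 < enorm v by rewrite lt_neqAle eq_sym v0 enorm_ge0.
have := sqr_ge0 (enorm (enorm v *: u - enorm u *: v)).
rewrite sqr_enorm dotDl !dotDr !dotNl !dotNr !dotZl !dotZr -!sqr_enorm.
rewrite (dotC v u) => h.
have : 0 <= (enorm u * enorm v) * (2 * (enorm u * enorm v - dot u v)).
  by apply: le_trans h _; rewrite le_eqVlt; apply/orP; left; apply/eqP; ring.
by rewrite pmulr_rge0 ?mulr_gt0// pmulr_rge0// subr_ge0.
Qed.

Lemma ler_enormD u v : enorm (u + v) <= enorm u + enorm v.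
Proof.
rewrite -(@ler_pXn2r _ 2)// ?nnegrE ?addr_ge0 ?enorm_ge0//.
rewrite sqr_enorm dotDl !dotDr -!sqr_enorm (dotC v u).
have := dot_le_enorm u v; lra.
Qed.

Lemma enorm_distC u v : enorm (u - v) = enorm (v - u).
Proof. by rewrite -enormN opprB. Qed.

Lemma enorm_normalized (a : R) (m : 'rV[R]_d) : 0 <= a ->
  enorm ((a / enorm m) *: m) <= a.
Proof.
move=> a0; rewrite enormZ ger0_norm ?divr_ge0 ?enorm_ge0//.
have [->|m0] := eqVneq (enorm m) 0; first by rewrite mulr0.
by rewrite divfK.
Qed.

(** Moving along the normalized direction of [m] loses only twice the distance
    from [m] to [g] compared with moving along [g] itself: one loss comes from
    [dot g m], the other from replacing the length of [m] by that of [g].  For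
    [m = 0] the right-hand side is [0] and [enorm (m - g)] is [enorm g]. *)
Lemma dot_normalized (a : R) (g m : 'rV[R]_d) : 0 <= a ->
  a * enorm g - 2 * a * enorm (m - g) <= dot g ((a / enorm m) *: m).
Proof.
move=> a0; rewrite dotZr -mulrA -mulrA mulrCA -mulrBr ler_wpM2l//.
have gm : enorm g <= enorm m + enorm (m - g).
  by rewrite -{1}(subKr m g); apply: le_trans (ler_enormD _ _) _; rewrite enormN.
have [m0|m0] := eqVneq (enorm m) 0.
  rewrite m0 invr0 mul0r; move: gm; rewrite m0.
  have := enorm_ge0 (m - g); lra.
have mp : 0 < enorm m by rewrite lt_neqAle eq_sym m0 enorm_ge0.
have dgm : dot g m = enorm m ^+ 2 - dot (m - g) m.
  by rewrite sqr_enorm dotDl dotNl; ring.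
rewrite [leRHS]mulrC ler_pdivlMr// dgm.
have := dot_le_enorm (m - g) m.
have := enorm_ge0 (m - g); nra.
Qed.

End euclidean.

(** Every step satisfies [L1 * eta <= 1 / 12], so the smoothness inequality is
    only needed at [c = 1 / 12]; these bounds make both [A0 c] and [A1 c] at
    most [2]. *)
Lemma expR_twelfth {R : realType} : 13 / 12 <= expR (1 / 12 : R) <= 12 / 11.
Proof.
have h1 := @expR_ge1Dx R (1 / 12); have h2 := @expR_ge1Dx R (- (1 / 12)).
apply/andP; split; first lra.
have e0 := expR_gt0 (1 / 12 : R).
have : expR (1 / 12) * expR (- (1 / 12)) = 1 :> R by rewrite expRxMexpNx_1.
nra.
Qed.


Section descent.
Context {R : realType} {d : nat}.
Variables (L0 L1 : R) (F : 'rV[R]_d -> R).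
Hypotheses (L0_ge0 : 0 <= L0) (L1_gt0 : 0 < L1) (smF : L0L1_smooth L0 L1 F).

Lemma grad_lipschitz x y : L1 * enorm (x - y) <= 1 / 12 ->
  enorm (grad F x - grad F y) <=
    (2 * L0 + 2 * L1 * enorm (grad F x)) * enorm (x - y).
Proof.
move=> xy; have c0 : 0 < 1 / 12 :> R by lra.
apply: (le_trans (smF.2 _ _ _ c0 xy)).
apply: ler_wpM2r; first exact: enorm_ge0.
have /andP[e1 e2] := @expR_twelfth R.
have a1 : A1 (1 / 12 : R) <= 2 by rewrite /A1; lra.
have a0 : A0 (1 / 12 : R) <= 2 by rewrite /A0; lra.
by rewrite lerD// ?ler_wpM2r ?enorm_ge0// ?ltW.
Qed.

Lemma derive_grad x v : 'D_v F x = dot (grad F x) v.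
Proof.
have dF := smF.1 x.
rewrite deriveE// {1}(row_sum_delta v) linear_sum; apply: eq_bigr => i _.
by rewrite linearZ /= mxE deriveE// mulrC.
Qed.

(** The mean value theorem along a segment replaces the integral form of the
    remainder.  It costs a factor [2] in the quadratic term of [descent], which
    the choice of the stepsizes leaves room for. *)
Lemma segment_mean_value x v : exists2 s : R, 0 <= s <= 1 &
  F (x + v) - F x = dot (grad F (x + s *: v)) v.
Proof.
pose f (s : R) : R := F (x + s *: v).
pose df (s : R) : R := dot (grad F (x + s *: v)) v.
have dfE s : is_derive s (1 : R) f (df s).
  have dg : is_diff s (fun t : R => x + t *: v : 'rV[R]_d) (fun t : R => t *: v).
    have := @is_diffD _ _ _ (cst x) (fun t : R => t *: v) _ _ s
      (is_diff_cst _ _) (is_diff_scalel s v).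
    move=> h; apply: is_diff_eq h _.
    by apply/funext => t /=; rewrite add0r.
  have dF := smF.1 (x + s *: v).
  have dfs : is_diff s f ('d F (x + s *: v) \o (fun t : R => t *: v)).
    exact: (@is_diff_comp _ _ _ _ _ _ F _ s dg (differentiableP dF)).
  have dfs1 : differentiable f s by [].
  apply: DeriveDef; first exact: diff_derivable.
  by rewrite deriveE ?diff_val//= scale1r -deriveE// derive_grad.
have [s s01 fs] : exists2 s, s \in `]0, 1[%R & f 1 - f 0 = df s * (1 - 0).
  apply: MVT => //.
  apply: continuous_subspaceT => s; apply: differentiable_continuous.
  by apply/derivable1_diffP; have := dfE s; case.
exists s.
  by move: s01; rewrite in_itv/= => /andP[/ltW-> /ltW->].
by move: fs; rewrite /f /df scale1r scale0r addr0 subr0 mulr1.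
Qed.

Lemma descent x v : L1 * enorm v <= 1 / 12 ->
  F (x + v) <= F x + dot (grad F x) v
    + (2 * L0 + 2 * L1 * enorm (grad F x)) * enorm v ^+ 2.
Proof.
move=> v12; have [s /andP[s0 s1] fs] := segment_mean_value x v.
have nsv : enorm (x - (x + s *: v)) = s * enorm v.
  by rewrite opprD addNKr enormN enormZ ger0_norm.
have sv : s * enorm v <= enorm v by rewrite ler_piMl ?enorm_ge0.
have lip : enorm (grad F x - grad F (x + s *: v)) <=
    (2 * L0 + 2 * L1 * enorm (grad F x)) * (s * enorm v).
  rewrite -nsv; apply: grad_lipschitz; rewrite nsv; apply: le_trans v12.
  by rewrite ler_wpM2l// ltW.
have K0 : 0 <= 2 * L0 + 2 * L1 * enorm (grad F x).
  by rewrite addr_ge0 ?mulr_ge0 ?enorm_ge0// ltW.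
have -> : F (x + v) = F x + dot (grad F x) v
    + dot (grad F (x + s *: v) - grad F x) v.
  by rewrite dotDl dotNl -fs; ring.
rewrite lerD2l; apply: le_trans (dot_le_enorm _ _) _.
rewrite enorm_distC expr2 mulrA ler_wpM2r ?enorm_ge0//.
by apply: le_trans lip _; rewrite ler_wpM2l.
Qed.

End descent.

(** * The pathwise potential argument *)

Section normalized_step.
Context {R : realType} {d : nat}.
Variables (L0 L1 : R) (F : 'rV[R]_d -> R).
Hypotheses (L0_ge0 : 0 <= L0) (L1_gt0 : 0 < L1) (smF : L0L1_smooth L0 L1 F).

Let K x : R := 2 * L0 + 2 * L1 * enorm (grad F x).

Let K_ge0 x : 0 <= K x.
Proof. by rewrite /K addr_ge0 ?mulr_ge0 ?enorm_ge0// ltW. Qed.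

Lemma normalized_step_descent (a : R) (x m : 'rV[R]_d) :
  0 <= a -> L1 * a <= 1 / 12 ->
  F (x - (a / enorm m) *: m) <=
    F x - a * enorm (grad F x) + 2 * a * enorm (m - grad F x) + K x * a ^+ 2.
Proof.
move=> a0 a12; set v := (a / enorm m) *: m.
have va : enorm v <= a by exact: enorm_normalized.
have vL : L1 * enorm (- v) <= 1 / 12.
  by rewrite enormN; apply: le_trans a12; rewrite ler_wpM2l// ltW.
apply: le_trans (descent L0_ge0 L1_gt0 smF x vL) _.
rewrite enormN dotNr -/(K x).
have := dot_normalized (grad F x) m a0; rewrite -/v.
have : K x * enorm v ^+ 2 <= K x * a ^+ 2.
  by rewrite ler_wpM2l// ler_pXn2r// nnegrE ?enorm_ge0.
lra.
Qed.

Lemma normalized_step_grad (a : R) (x m : 'rV[R]_d) :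
  0 <= a -> L1 * a <= 1 / 12 ->
  enorm (grad F x - grad F (x - (a / enorm m) *: m)) <= K x * a.
Proof.
move=> a0 a12; set v := (a / enorm m) *: m.
have va : enorm v <= a by exact: enorm_normalized.
have xv : enorm (x - (x - v)) = enorm v by rewrite subKr.
have vL : L1 * enorm (x - (x - v)) <= 1 / 12.
  by rewrite xv; apply: le_trans a12; rewrite ler_wpM2l// ltW.
apply: le_trans (grad_lipschitz L0_ge0 L1_gt0 smF vL) _.
by rewrite xv ler_wpM2l//; exact: K_ge0.
Qed.

End normalized_step.

Section parameters.
Context {R : realType}.
Implicit Types (t : nat).

(** All parameters are monomials in [t^(-1/4)]: the stepsize is its cube up to a
    constant, the decay is one minus its square, and its fourth power is [1/t].
    The estimates on the parameters thus become polynomial inequalities. *)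
Definition inv_root4 t : R := t%:R `^ (- (1 / 4)).

Lemma inv_root4_ge0 t : 0 <= inv_root4 t. Proof. exact: powR_ge0. Qed.

Lemma inv_root4_0 : inv_root4 0 = 0.
Proof. by rewrite /inv_root4 powR0// lt_eqF//; lra. Qed.

Lemma inv_root4_gt0 t : (0 < t)%N -> 0 < inv_root4 t.
Proof. by move=> t0; rewrite powR_gt0// ltr0n. Qed.

Lemma inv_root4X t n : inv_root4 t ^+ n = t%:R `^ (- (n%:R / 4)).
Proof.
by rewrite -powR_mulrn ?powR_ge0// -powRrM; congr (_ `^ _); lra.
Qed.

Lemma inv_root4_exp4 t : inv_root4 t ^+ 4 = t%:R^-1.
Proof.
rewrite inv_root4X; have -> : - (4%:R / 4) = -1 :> R by lra.
by rewrite powR_inv1.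
Qed.

Lemma le_inv_root4 s t : (0 < s)%N -> (s <= t)%N -> inv_root4 t <= inv_root4 s.
Proof.
move=> s0 st; rewrite /inv_root4 !powRN lef_pV2 ?posrE ?powR_gt0 ?ltr0n//; last first.
  exact: leq_trans st.
by rewrite ge0_ler_powR ?nnegrE ?ler0n ?ler_nat//; lra.
Qed.

Lemma inv_root4_le1 t : (0 < t)%N -> inv_root4 t <= 1.
Proof.
move=> t0; have <- : inv_root4 1 = 1 by rewrite /inv_root4 powR1.
exact: le_inv_root4.
Qed.

(** The weight of the drift in the potential contracts.  At [t = 0] both sides
    vanish, since [0 `^ a = 0] for [a != 0] and the first decay is [0]: the
    drift of the initial state, which is not small, enters with weight [0]. *)
Lemma inv_root4_drift t : (1 - inv_root4 t.+1 ^+ 4) * inv_root4 t.+1 <= inv_root4 t.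
Proof.
case: t => [|t]; first by rewrite inv_root4_exp4 invr1 subrr mul0r inv_root4_ge0.
apply: le_trans (@le_inv_root4 t.+1 t.+2 _ _) => //.
by rewrite ler_piMl ?inv_root4_ge0// gerBl exprn_ge0 ?inv_root4_ge0.
Qed.

(** Induction step for the bound [2 t^(-1/2) sigma^2] on the second moment of
    the noise.  With [p = (t+1)^(-1/2)] and [p' = t^(-1/2)] it follows from
    [p' (1 - p) <= p], which holds because [p'^2 (1 - p^2) = p^2] for [t > 0]. *)
Lemma noise_recursion_bound t :
  (1 - inv_root4 t.+1 ^+ 2) ^+ 2 * (2 * inv_root4 t ^+ 2) + (inv_root4 t.+1 ^+ 2) ^+ 2 <=
  2 * inv_root4 t.+1 ^+ 2 :> R.
Proof.
set p := inv_root4 t.+1 ^+ 2; set p' := inv_root4 t ^+ 2.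
have p0 : 0 <= p by exact: sqr_ge0.
have p'0 : 0 <= p' by exact: sqr_ge0.
have p1 : p <= 1 by rewrite exprn_ile1 ?inv_root4_ge0 ?inv_root4_le1.
have pp : p' * (1 - p) <= p.
  rewrite -(@ler_pXn2r _ 2)// ?nnegrE//; last by rewrite (mulr_ge0 p'0)// subr_ge0.
  have h : p' ^+ 2 * (1 - p ^+ 2) <= p ^+ 2.
    rewrite /p /p' -!exprM !inv_root4_exp4; case: t {p p' p0 p'0 p1} => [|t].
      by rewrite invr0 mul0r invr_ge0.
    have h1 : 0 < t.+1%:R :> R by rewrite ltr0n.
    have -> : t.+2%:R = t.+1%:R + 1 :> R by rewrite -natr1.
    rewrite le_eqVlt; apply/orP; left; apply/eqP; field.
    by rewrite !gt_eqF//; lra.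
  apply: le_trans h; rewrite exprMn ler_wpM2l ?sqr_ge0//; nra.
have : (1 - p) * (p' * (1 - p)) <= (1 - p) * p by apply: ler_wpM2l; rewrite ?subr_ge0.
clearbody p p'; nra.
Qed.

End parameters.

Section potential.
Context {R : realType} {d : nat} {Xi : Type}.
Variables (L0 L1 : R) (F : 'rV[R]_d -> R).
Hypotheses (L0_ge0 : 0 <= L0) (L1_gt0 : 0 < L1) (smF : L0L1_smooth L0 L1 F).
Variables (G : 'rV[R]_d -> Xi -> 'rV[R]_d) (x1 : 'rV[R]_d) (z : nat -> Xi).

Definition stepsize (t : nat) : R := inv_root4 t ^+ 3 / (12 * L1).
Definition decay (t : nat) : R := 1 - inv_root4 t ^+ 2.

Local Notation state := (nsgdm_state G stepsize decay x1 z).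
Local Notation x := (nsgdm G stepsize decay x1 z).

Fixpoint noise_average (t : nat) : 'rV[R]_d :=
  if t is s.+1 then
    decay t *: noise_average s + (1 - decay t) *: (G (x t) (z t) - grad F (x t))
  else 0.

(** The gradient is taken at the iterate that follows the momentum.  With this
    choice one step first multiplies the drift by the decay, exactly
    ([tracking_error]), and then adds the change of the gradient. *)
Definition drift t : R := enorm ((state t).2 - noise_average t - grad F (x t.+1)).

Lemma nsgdm_stateS t : state t.+1 =
  (x t.+1 - (stepsize t.+1 / enorm (state t.+1).2) *: (state t.+1).2,
   decay t.+1 *: (state t).2 + (1 - decay t.+1) *: G (x t.+1) (z t.+1)).
Proof. by rewrite /nsgdm/=; case: (state t). Qed.

Lemma stepsize_ge0 t : 0 <= stepsize t.
Proof. by rewrite divr_ge0 ?exprn_ge0 ?inv_root4_ge0// mulr_ge0// ltW. Qed.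

Lemma stepsize_le t : L1 * stepsize t.+1 <= 1 / 12.
Proof.
have -> : L1 * stepsize t.+1 = inv_root4 t.+1 ^+ 3 / 12.
  by rewrite /stepsize; field; rewrite gt_eqF.
by rewrite ler_pM2r ?invr_gt0// exprn_ile1 ?inv_root4_ge0 ?inv_root4_le1.
Qed.

Lemma tracking_error t :
  (state t.+1).2 - noise_average t.+1 - grad F (x t.+1) =
  decay t.+1 *: ((state t).2 - noise_average t - grad F (x t.+1)).
Proof.
rewrite nsgdm_stateS/=; apply/rowP => i; rewrite !mxE; ring.
Qed.

(** The descent inequality contributes [2 eta_t] times the drift; the weight of
    the drift is chosen such that this is paid for by its contraction.  The
    quadratic remainder of the descent inequality and the growth of the drift
    together consume at most half of the gradient term. *)
Lemma potential_decrease t :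
  F (x t.+2) + inv_root4 t.+1 / (6 * L1) * drift t.+1
    + stepsize t.+1 * enorm (grad F (x t.+1)) / 2 <=
  F (x t.+1) + inv_root4 t / (6 * L1) * drift t
    + 2 * stepsize t.+1 * enorm (noise_average t.+1)
    + L0 / (24 * L1 ^+ 2) * (t.+1)%:R^-1.
Proof.
set q := inv_root4 t.+1; set q' := inv_root4 t.
have q0 : 0 < q by exact: inv_root4_gt0.
have q1 : q <= 1 by exact: inv_root4_le1.
have qq : (1 - q ^+ 4) * q <= q' by exact: inv_root4_drift.
have b0 : 0 <= decay t.+1 by rewrite subr_ge0 exprn_ile1// ltW.
set m := (state t.+1).2; set y := x t.+1.
have xS : x t.+2 = y - (stepsize t.+1 / enorm m) *: m.
  by rewrite [LHS]/nsgdm [t.+2.-1]/= nsgdm_stateS.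
have a0 := stepsize_ge0 t.+1; have a12 := stepsize_le t.
have := normalized_step_descent L0_ge0 L1_gt0 smF y m a0 a12.
have := normalized_step_grad L0_ge0 L1_gt0 smF y m a0 a12.
rewrite -xS; set g := enorm (grad F y); set a := stepsize t.+1.
set S := enorm (_ - _); set e := enorm (m - _) => hS hF.
have g0 : 0 <= g by exact: enorm_ge0.
have r0 : 0 <= drift t by exact: enorm_ge0.
have he : e <= enorm (noise_average t.+1) + decay t.+1 * drift t.
  rewrite /drift -{1}(ger0_norm b0) -enormZ -tracking_error.
  apply: le_trans (ler_enormD _ _); rewrite le_eqVlt; apply/orP; left.
  by apply/eqP; congr enorm; rewrite addrA subrKC.
have hr : drift t.+1 <= decay t.+1 * drift t + S.
  rewrite /drift -{1}(ger0_norm b0) -enormZ -tracking_error.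
  apply: le_trans (ler_enormD _ _); rewrite le_eqVlt; apply/orP; left.
  by apply/eqP; congr enorm; rewrite addrA subrK.
set n := enorm (noise_average t.+1) in he *.
have aE : a = q ^+ 3 / (12 * L1) by [].
have bE : decay t.+1 = 1 - q ^+ 2 by [].
have w0 : 0 <= q / (6 * L1) by rewrite divr_ge0 ?mulr_ge0// ltW.
have wr := ler_wpM2l w0 (le_trans hr (lerD (lexx _) hS)).
have ae := ler_wpM2l a0 he; rewrite -/a in ae.
(* [2 * a] is [q ^+ 2] times [q / (6 * L1)], so the factors [1 + q ^+ 2] and
   [1 - q ^+ 2] meet. *)
have hd : (2 * a + q / (6 * L1)) * decay t.+1 * drift t <= q' / (6 * L1) * drift t.
  rewrite ler_wpM2r//.
  have -> : (2 * a + q / (6 * L1)) * decay t.+1 = (1 - q ^+ 4) * q / (6 * L1).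
    by rewrite aE bE; field; rewrite gt_eqF.
  by rewrite ler_pM2r// invr_gt0 mulr_gt0.
have hK : (a + q / (6 * L1)) * a * (2 * L0 + 2 * L1 * g) <=
    a * g / 2 + L0 / (24 * L1 ^+ 2) * (t.+1)%:R^-1.
  (* [q <= 1] gives [a <= q / (12 * L1)]. *)
  have aw : a + q / (6 * L1) <= q / (4 * L1).
    have -> : q / (4 * L1) = q / (12 * L1) + q / (6 * L1).
      by field; rewrite gt_eqF.
    rewrite lerD2r aE ler_pM2r ?invr_gt0 ?mulr_gt0//.
    by rewrite exprS ler_piMr ?(ltW q0)// exprn_ile1// ltW.
  have K0 : 0 <= a * (2 * L0 + 2 * L1 * g).
    by rewrite mulr_ge0// addr_ge0 ?mulr_ge0// ltW.
  rewrite -mulrA; apply: le_trans (ler_wpM2r K0 aw) _.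
  have -> : q / (4 * L1) * (a * (2 * L0 + 2 * L1 * g)) =
      q * (a * g / 2) + L0 / (24 * L1 ^+ 2) * q ^+ 4.
    by rewrite aE; field; rewrite gt_eqF.
  rewrite -(inv_root4_exp4 t.+1) -/q lerD2r ler_piMl//.
  by rewrite divr_ge0// mulr_ge0.
move: wr hd hK; set c := L0 / _ / _; set w := q / _; set w' := q' / _.
move: (w) (w') (c) => {}w {}w' {}c wr hd hK; lra.
Qed.

Lemma potential_sum T :
  F (x T.+1) + \sum_(1 <= t < T.+1) stepsize t * enorm (grad F (x t)) / 2 <=
  F x1 + \sum_(1 <= t < T.+1) (2 * stepsize t * enorm (noise_average t)
    + L0 / (24 * L1 ^+ 2) * t%:R^-1).
Proof.
suff h : F (x T.+1) + inv_root4 T / (6 * L1) * drift T +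
    \sum_(1 <= t < T.+1) stepsize t * enorm (grad F (x t)) / 2 <=
    F x1 + \sum_(1 <= t < T.+1) (2 * stepsize t * enorm (noise_average t)
    + L0 / (24 * L1 ^+ 2) * t%:R^-1).
  apply: le_trans h; rewrite lerD2r lerDl mulr_ge0 ?enorm_ge0//.
  by rewrite divr_ge0 ?inv_root4_ge0// mulr_ge0// ltW.
elim: T => [|T IH].
  by rewrite !big_geq// inv_root4_0 !mul0r !addr0.
rewrite !(big_nat_recr T.+1)//=.
move: IH (potential_decrease T); set w := _ / _ * _; set w' := _ / _ * _.
set c := L0 / _ / _; move: (w) (w') (c) => {}w {}w' {}c; lra.
Qed.

Lemma pathwise_bound (Fstar : R) T : (forall y, Fstar <= F y) ->
  \sum_(1 <= t < T.+1) stepsize t * enorm (grad F (x t)) <=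
  2 * (F x1 - Fstar) + \sum_(1 <= t < T.+1) (4 * stepsize t * enorm (noise_average t)
    + L0 / (12 * L1 ^+ 2) * t%:R^-1).
Proof.
move=> Fs; have := potential_sum T; have := Fs (x T.+1).
rewrite -mulr_suml => h1 h2.
have -> : \sum_(1 <= t < T.+1) (4 * stepsize t * enorm (noise_average t)
    + L0 / (12 * L1 ^+ 2) * t%:R^-1) = 2 * \sum_(1 <= t < T.+1)
    (2 * stepsize t * enorm (noise_average t) + L0 / (24 * L1 ^+ 2) * t%:R^-1).
  rewrite mulr_sumr; apply: eq_big_nat => t _.
  have -> : L0 / (12 * L1 ^+ 2) = 2 * (L0 / (24 * L1 ^+ 2)).
    by field; rewrite gt_eqF.
  ring.
lra.
Qed.

End potential.

(** * Markov chains driven by independent samples *)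

Section rectangles.
Local Open Scope ereal_scope.
Context d1 d2 (T1 : measurableType d1) (T2 : measurableType d2) (R : realType).

(** Rectangles form a pi-system generating the product sigma-algebra. *)
Lemma eq_measure_rectangle (mu nu : {measure set (T1 * T2) -> \bar R}) :
  mu setT < +oo ->
  (forall A B, measurable A -> measurable B -> mu (A `*` B) = nu (A `*` B)) ->
  forall C, measurable C -> mu C = nu C.
Proof.
move=> muoo munu C mC.
pose rect := [set A `*` B | A in @measurable _ T1 & B in @measurable _ T2].
apply: (measure_unique rect (fun=> setT)) => //.
- exact: measurable_prod_measurableType.
- move=> _ _ [A1 mA1 [B1 mB1 <-]] [A2 mA2 [B2 mB2 <-]].
  exists (A1 `&` A2); first exact: measurableI.
  by exists (B1 `&` B2); [exact: measurableI|rewrite setXI].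
- by move=> _; exists setT => //; exists setT => //; rewrite setXTT.
- by rewrite bigcup_const//; exists 0%N.
- by move=> _ [A mA [B mB <-]]; exact: munu.
Qed.

End rectangles.

Section markov_chain.
Context (R : realType) (dO dX dS : measure_display).
Context (Omega : measurableType dO) (Xi : measurableType dX).
Context (S : measurableType dS) (P : probability Omega R).
Variables (xi : {RV P >-> Xi}) (xis : nat -> {RV P >-> Xi}).
Hypothesis xis_indep : mutually_independent [set t | (1 <= t)%N] xis.
Hypothesis xis_law : forall t, (1 <= t)%N -> same_law (xis t) xi.
Variables (Phi : nat -> S * Xi -> S) (y0 : S).
Hypothesis mPhi : forall t, measurable_fun setT (Phi t).

Fixpoint chain (z : nat -> Xi) (t : nat) : S :=
  if t is s.+1 then Phi t (chain z s, z t) else y0.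

Let Y t w := chain (fun s => xis s w) t.

Lemma measurable_chain t :
  measurable_fun setT (fun w => chain (fun s => xis s w) t).
Proof.
elim: t => [|t IH]; first exact: measurable_cst.
apply: (measurableT_comp (mPhi t.+1)).
by apply: measurable_fun_pair => //; exact: measurable_funP.
Qed.

Let mY t : measurable_fun setT (Y t). Proof. exact: measurable_chain. Qed.

Let Yrv t : {RV P >-> S} :=
  HB.pack (Y t) (isMeasurableFun.Build _ _ _ _ _ (mY t)).

Let future (s : seq nat) (A : nat -> set Xi) : set Omega :=
  \bigcap_(i in [set` s]) (xis i @^-1` A i).

Let measurable_xis t A : measurable A -> measurable (xis t @^-1` A).
Proof. by move=> mA; rewrite -[X in measurable X]setTI; exact: measurable_funP. Qed.

Let measurable_future s A : (forall i, i \in s -> measurable (A i)) ->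
  measurable (future s A).
Proof.
move=> mA; apply: fin_bigcap_measurable; first exact: finite_seq.
by move=> i /= /mA; exact: measurable_xis.
Qed.

(** Independence of the next sample alone would not be preserved by the
    induction on [t], hence the arbitrary finite family of future samples.  In
    the step, both sides are finite measures in the joint event for the state
    and the next sample; on rectangles they agree by the induction hypothesis,
    applied with the next sample moved into the future family. *)
Lemma chain_indep_future t (s : seq nat) (A : nat -> set Xi) (B : set S) :
  uniq s -> (forall i, i \in s -> (t < i)%N) ->
  (forall i, i \in s -> measurable (A i)) -> measurable B ->
  P (Y t @^-1` B `&` future s A) = (P (Y t @^-1` B) * P (future s A))%E.
Proof.
elim: t => [|t IH] in s A B *.
  move=> us s0 mA mB.
  have [By|By] := pselect (B y0).
    have -> : Y 0 @^-1` B = setT by apply/seteqP; split.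
    by rewrite setTI probability_setT mul1e.
  have -> : Y 0 @^-1` B = set0 by apply/seteqP; split.
  by rewrite set0I measure0 mul0e.
move=> us st mA mB; set E := future s A.
have mE : measurable E by exact: measurable_future.
pose h w := (Y t w, xis t.+1 w).
have mh : measurable_fun setT h.
  by apply: measurable_fun_pair => //; exact: measurable_funP.
have YE : Y t.+1 @^-1` B = h @^-1` (Phi t.+1 @^-1` B) by [].
have mC : measurable (Phi t.+1 @^-1` B).
  by rewrite -[X in measurable X]setTI; exact: mPhi.
rewrite {}YE; move: (Phi t.+1 @^-1` B) mC => C mC.
have PE : P E \is a fin_num by exact: fin_num_measure.
have PE0 : (0 <= fine (P E))%R by exact: fine_ge0.
pose hrv : {RV P >-> (S * Xi)%type} :=
  HB.pack h (isMeasurableFun.Build _ _ _ _ _ mh).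
pose mu := pushforward (mrestr P mE) hrv.
(* Rescaling by the probability of [E] turns the product formula into an
   equality of two measures. *)
pose nu := mscale (NngNum PE0) (distribution P hrv).
have : mu C = nu C.
  apply: eq_measure_rectangle => //.
    rewrite /mu /= /pushforward/= /mrestr.
    by rewrite (le_lt_trans (probability_le1 _ _)) ?ltry//= preimage_setT setTI.
  move=> B' A' mB' mA'; rewrite -[LHS]/(P (h @^-1` (B' `*` A') `&` E)).
  rewrite -[RHS]/((fine (P E))%:E * P (h @^-1` (B' `*` A')))%E.
  have ts : t.+1 \notin s by apply/negP => /st; rewrite ltnn.
  pose A1 i := if i == t.+1 then A' else A i.
  have AE : future s A1 = E.
    apply: eq_bigcapr => i/= si; rewrite /A1; case: eqP => // it.
    by move: ts; rewrite -it si.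
  have futS : xis t.+1 @^-1` A' `&` E = future (t.+1 :: s) A1.
    rewrite -AE; apply/seteqP; split=> w.
      move=> [wA' wE] i/=; rewrite inE => /orP[/eqP ->|si].
        by rewrite /A1 eqxx.
      exact: wE.
    move=> wE; split; last first.
      by move=> i/= si; apply: wE; rewrite /= inE si orbT.
    have /= := wE t.+1; rewrite /A1 eqxx; apply.
    by rewrite mem_head.
  have mA1 i : i \in t.+1 :: s -> measurable (A1 i).
    by rewrite inE /A1; case: eqP => //= _ /mA.
  have ut : uniq (t.+1 :: s) by rewrite /= ts.
  have hBA : h @^-1` (B' `*` A') = Y t @^-1` B' `&` xis t.+1 @^-1` A' by [].
  rewrite hBA -setIA futS IH//; last first.
    by move=> i; rewrite inE => /orP[/eqP->//|/st/ltnW].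
  have -> : Y t @^-1` B' `&` xis t.+1 @^-1` A' =
      Y t @^-1` B' `&` future [:: t.+1] (fun=> A').
    congr (_ `&` _); rewrite /future.
    have -> : [set` [:: t.+1]] = [set t.+1].
      by apply/seteqP; split=> i/=; rewrite inE => /eqP.
    by rewrite bigcap_set1.
  rewrite IH//; last by move=> i; rewrite inE => /eqP ->.
  rewrite fineK//; rewrite [RHS]muleC -muleA; congr (_ * _)%E.
  rewrite /future xis_indep//; last first.
    by move=> i/=; rewrite inE => /orP[/eqP->//|/st]; exact: leq_ltn_trans.
  rewrite xis_indep//; last by move=> i/=; rewrite inE => /eqP ->.
  rewrite !big_cons big_nil mule1 /A1 eqxx; congr (_ * _)%E.
  rewrite -AE /future xis_indep//; last 2 first.
  - by move=> i/= /st; exact: leq_ltn_trans.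
  - by move=> i si; apply: mA1; rewrite inE si orbT.
rewrite /mu /nu /mscale /distribution /pushforward/= /mrestr fineK// => ->.
by rewrite muleC.
Qed.

Lemma chain_law t (C : set (S * Xi)) : measurable C ->
  P ((fun w => (Y t w, xis t.+1 w)) @^-1` C) =
  (distribution P (Yrv t) \x distribution P xi)%E C.
Proof.
pose h w := (Y t w, xis t.+1 w).
have mh : measurable_fun setT h.
  by apply: measurable_fun_pair => //; exact: measurable_funP.
pose hrv : {RV P >-> (S * Xi)%type} :=
  HB.pack h (isMeasurableFun.Build _ _ _ _ _ mh).
move=> mC; apply/esym; rewrite -[RHS]/(distribution P hrv C).
apply: product_measure_unique => // B A mB mA.
rewrite -[RHS]/(P (Y t @^-1` B) * distribution P xi A)%E.
rewrite -(xis_law (ltn0Sn t) mA) -[LHS]/(P (h @^-1` (B `*` A))).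
have := @chain_indep_future t [:: t.+1] (fun=> A) B.
rewrite /future; have -> : [set` [:: t.+1]] = [set t.+1].
  by apply/seteqP; split=> i/=; rewrite inE => /eqP.
rewrite bigcap_set1; apply => // i.
by rewrite inE => /eqP ->.
Qed.

(** Plays the role of conditioning on the past: the new sample may be replaced
    by an independent one and integrated first, the state being frozen. *)
Lemma integral_chain t (f : S * Xi -> \bar R) :
  measurable_fun [set: S * Xi] f -> (forall p, (0 <= f p)%E) ->
  (\int[P]_w f (chain (fun s => xis s w) t, xis t.+1 w) =
   \int[P]_w' \int[P]_w f (chain (fun s => xis s w') t, xi w))%E.
Proof.
move=> mf f0.
have mh : measurable_fun setT (fun w => (Y t w, xis t.+1 w)).
  by apply: measurable_fun_pair => //; exact: measurable_funP.
pose hrv : {RV P >-> (S * Xi)%type} :=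
  HB.pack (fun w => (Y t w, xis t.+1 w)) (isMeasurableFun.Build _ _ _ _ _ mh).
transitivity (\int[distribution P hrv]_p f p)%E.
  by rewrite ge0_integral_distribution.
rewrite (@eq_measure_integral _ _ _ _ (distribution P (Yrv t) \x distribution P xi)%E);
  last by move=> C mC _; exact: chain_law.
rewrite fubini_tonelli1// ge0_integral_distribution//; last 2 first.
- exact: measurable_fun_fubini_tonelli_F.
- by move=> y; apply: integral_ge0.
apply: eq_integral => w _; rewrite /= /fubini_F ge0_integral_distribution//.
by apply: measurableT_comp => //; exact: measurable_pair1.
Qed.

End markov_chain.

(** * Measurability and moments of the oracle *)

Section measurable_row.
Context {R : realType} {d : nat} {dT : measure_display} {T : measurableType dT}.
Implicit Types f g : T -> 'rV[R]_d.

(** Measurability of maps into [R^d] is a matter of coordinates, while the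
    product sigma-algebra lives on tuples; these are the two conversions. *)
Definition row_of_tuple (a : d.-tuple R) : 'rV[R]_d := \row_j tnth a j.
Definition tuple_of_row (v : 'rV[R]_d) : d.-tuple R := [tuple v 0 i | i < d].

Lemma tuple_of_rowK : cancel tuple_of_row row_of_tuple.
Proof. by move=> v; apply/rowP => i; rewrite mxE tnth_mktuple. Qed.

Definition measurable_row f := forall i, measurable_fun setT (fun t => f t 0 i).

Lemma measurable_rowD f g : measurable_row f -> measurable_row g ->
  measurable_row (fun t => f t + g t).
Proof.
move=> mf mg i; under eq_fun do rewrite mxE.
exact: measurable_funD.
Qed.

Lemma measurable_rowZ (a : T -> R) f : measurable_fun setT a ->
  measurable_row f -> measurable_row (fun t => a t *: f t).
Proof.
move=> ma mf i; under eq_fun do rewrite mxE.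
exact: measurable_funM.
Qed.

Lemma measurable_rowB f g : measurable_row f -> measurable_row g ->
  measurable_row (fun t => f t - g t).
Proof.
move=> mf mg i; under eq_fun do rewrite !mxE.
exact: measurable_funB.
Qed.

Lemma measurable_enorm f : measurable_row f ->
  measurable_fun setT (fun t => enorm (f t)).
Proof.
move=> mf; rewrite /enorm.
rewrite (_ : (fun t => _) = (fun t => (\sum_(i < d) f t 0 i ^+ 2) `^ 2^-1)).
  2: by apply/funext => t; rewrite powR12_sqrt// sumr_ge0// => i _; exact: sqr_ge0.
apply: (@measurableT_comp _ _ _ _ _ _ (@powR R ^~ 2^-1)) => //.
by apply: measurable_sum => i; exact: measurable_funX.
Qed.

Lemma measurable_tuple_of_row f : measurable_row f ->
  measurable_fun setT (fun t => tuple_of_row (f t)).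
Proof.
move=> mf; apply/measurable_fun_tnthP => i; rewrite /comp.
under eq_fun do rewrite tnth_mktuple.
exact: mf.
Qed.

End measurable_row.

Lemma measurable_row_of_tuple {R : realType} {d : nat} {dT : measure_display}
    {T : measurableType dT} (f : T -> d.-tuple R) :
  measurable_fun setT f -> measurable_row (fun t => row_of_tuple (f t)).
Proof.
move=> mf i; under eq_fun do rewrite mxE.
by move/measurable_fun_tnthP : mf => /(_ i).
Qed.

Section oracle.
Context {R : realType} {d : nat} (dO dX : measure_display).
Context (Omega : measurableType dO) (Xi : measurableType dX).
Variables (P : probability Omega R) (xi : {RV P >-> Xi}).
Variables (G : 'rV[R]_d -> Xi -> 'rV[R]_d) (F : 'rV[R]_d -> R) (sigma : R).
Hypotheses (mG : measurable_oracle G) (unbG : unbiased_oracle xi G F).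
Hypothesis (varG : bounded_variance_oracle xi G F sigma).

Lemma measurable_row_oracle dT (T : measurableType dT) (f : T -> 'rV[R]_d)
    (g : T -> Xi) :
  measurable_row f -> measurable_fun setT g ->
  measurable_row (fun t => G (f t) (g t)).
Proof.
move=> mf mg i.
have := measurableT_comp (mG i) (measurable_fun_pair (measurable_tuple_of_row mf) mg).
by apply: eq_measurable_fun => t _ /=; rewrite -/(row_of_tuple _) tuple_of_rowK.
Qed.

(** By unbiasedness the gradient is an integral of the oracle over its second
    argument, thus measurable in the first one by Tonelli's theorem, applied to
    the positive and negative parts. *)
Lemma measurable_row_grad dT (T : measurableType dT) (f : T -> 'rV[R]_d) :
  measurable_row f -> measurable_row (fun t => grad F (f t)).
Proof.
move=> mf i; apply/measurable_EFinP.
pose h (p : T * Omega) : \bar R := (G (f p.1) (xi p.2) 0 i)%:E.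
have mh : measurable_fun setT h.
  apply/measurable_EFinP; apply: measurable_row_oracle.
    by move=> j; exact: (measurableT_comp (mf j)).
  exact: measurableT_comp.
have -> : EFin \o (fun t => grad F (f t) 0 i) =
    (fun t => fubini_F P (h^\+)%E t - fubini_F P (h^\-)%E t)%E.
  apply/funext => t /=; rewrite -unbG unlock integralE.
  by congr (_ - _)%E; apply: eq_integral => w _; rewrite ?funeposE ?funenegE.
apply: emeasurable_funB; apply: measurable_fun_fubini_tonelli_F => //.
- exact: measurable_funepos.
- exact: measurable_funeneg.
Qed.

Let X x w := G x (xi w) - grad F x.

Let mX x : measurable_row (X x).
Proof.
apply: measurable_rowB; last by move=> i; exact: measurable_cst.
exact: measurable_row_oracle.
Qed.

Let iX2 x : P.-integrable setT (EFin \o (fun w => enorm (X x w) ^+ 2)).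
Proof.
apply/integrableP; split.
  by apply/measurable_EFinP/measurable_funX/measurable_enorm.
under eq_integral do rewrite /= ger0_norm ?sqr_ge0//.
by have := varG x; rewrite unlock => /le_lt_trans; apply; rewrite ltry.
Qed.

Let iX x i : P.-integrable setT (EFin \o (fun w => X x w 0 i)).
Proof.
apply: (@le_integrable _ _ _ P _ _ _
  (EFin \o (fun w => 1 + enorm (X x w) ^+ 2))) => //.
- by apply/measurable_EFinP; exact: mX.
- move=> w _ /=; rewrite lee_fin [leRHS]ger0_norm ?addr_ge0 ?sqr_ge0//.
  have : `|X x w 0 i| ^+ 2 <= enorm (X x w) ^+ 2.
    rewrite real_normK ?num_real// sqr_enorm /dot (bigD1 i)//= -expr2 lerDl.
    by apply: sumr_ge0 => j _; rewrite -expr2 sqr_ge0.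
  have := sqr_ge0 (`|X x w 0 i| - 1); nra.
- rewrite (_ : EFin \o _ =
    (cst 1%:E \+ (EFin \o (fun w => enorm (X x w) ^+ 2)%R))%E)//.
  apply: integrableD => //; exact: finite_measure_integrable_cst.
Qed.

Let integral_X x i : (\int[P]_w (X x w 0 i)%:E = 0)%E.
Proof.
have iG : P.-integrable setT (EFin \o (fun w => G x (xi w) 0 i)).
  rewrite (_ : EFin \o _ = 
      (EFin \o (fun w => X x w 0 i)%R) \+ cst (grad F x 0 i)%:E)%E.
    by apply: integrableD => //; exact: finite_measure_integrable_cst.
  by apply/funext => w /=; rewrite -EFinD !mxE subrK.
have XE w : X x w 0 i = G x (xi w) 0 i - grad F x 0 i by rewrite !mxE.
under eq_integral do rewrite XE EFinB.
rewrite integralB//; last exact: finite_measure_integrable_cst.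
rewrite integral_cst//= probability_setT mule1.
by have := unbG x i; rewrite unlock => ->; rewrite -EFinB subrr.
Qed.

(** The cross term of the square vanishes because the oracle is unbiased; its
    integrability follows from the variance bound. *)
Lemma second_moment_step (x n : 'rV[R]_d) (a b : R) :
  (\int[P]_w (enorm (a *: n + b *: (G x (xi w) - grad F x)) ^+ 2)%:E <=
   (a ^+ 2 * enorm n ^+ 2 + b ^+ 2 * sigma ^+ 2)%:E)%E.
Proof.
have idot : P.-integrable setT (EFin \o (fun w => dot n (X x w))).
  rewrite (_ : _ \o _ = (fun w => \sum_(i < d) (n 0 i)%:E * (X x w 0 i)%:E)%E).
    by apply: integrable_sum => // i _; apply: integrableZl => //; exact: iX.
  by apply/funext => w /=; rewrite -sumEFin.
have dot0 : (\int[P]_w (dot n (X x w))%:E = 0)%E.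
  under eq_integral do rewrite -sumEFin.
  rewrite integral_sum//; last first.
    by move=> i; under eq_fun do rewrite EFinM; apply: integrableZl => //; exact: iX.
  rewrite big1// => i _; under eq_integral do rewrite EFinM.
  rewrite integralZl//; last exact: iX.
  by rewrite integral_X mule0.
have expand w : (enorm (a *: n + b *: (G x (xi w) - grad F x)) ^+ 2)%:E =
    ((a ^+ 2 * enorm n ^+ 2)%:E + ((2 * a * b)%:E * (dot n (X x w))%:E
      + (b ^+ 2)%:E * (enorm (X x w) ^+ 2)%:E))%E.
  rewrite -!EFinM -!EFinD; congr EFin; rewrite -/(X x w).
  move: (X x w) => Y.
  rewrite sqr_enorm dotDl !dotDr !dotZl !dotZr (dotC Y n) -!sqr_enorm.
  ring.
have i1 : P.-integrable setT (fun w => (2 * a * b)%:E * (dot n (X x w))%:E)%E.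
  exact: integrableZl.
have i2 : P.-integrable setT (fun w => (b ^+ 2)%:E * (enorm (X x w) ^+ 2)%:E)%E.
  by apply: integrableZl => //; exact: iX2.
under eq_integral do rewrite expand.
rewrite integralD//; last 2 first.
- exact: finite_measure_integrable_cst.
- exact: integrableD.
rewrite integralD// integral_cst//= probability_setT mule1.
rewrite integralZl// dot0 mule0 add0e integralZl//; last exact: iX2.
rewrite [leRHS]EFinD leeD2l// [leRHS]EFinM lee_wpmul2l ?lee_fin ?sqr_ge0//.
by have := varG x; rewrite unlock.
Qed.

End oracle.

(** * Moments of the averaged noise *)

(** Jensen's inequality for the square, obtained by integrating
    [X <= X^2 / (2 c) + c / 2] and letting [c] decrease to [v]; the value
    [c = v] itself is not available when [v = 0]. *)
Lemma expectation_le_sqrt_moment {R : realType} (dO : measure_display)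
    (Omega : measurableType dO) (P : probability Omega R) (X : Omega -> R) (v : R) :
  measurable_fun setT X -> (forall w, 0 <= X w) -> 0 <= v ->
  (\int[P]_w (X w ^+ 2)%:E <= (v ^+ 2)%:E -> \int[P]_w (X w)%:E <= v%:E)%E.
Proof.
move=> mX X0 v0 X2; apply/lee_addgt0Pr => e e0; set c := v + e.
have c0 : 0 < c by rewrite ltr_wpDl.
have ci : 0 <= (2 * c)^-1 by rewrite invr_ge0 mulr_ge0// ltW.
have mX2 : measurable_fun setT (fun w => (X w ^+ 2)%:E).
  by apply/measurable_EFinP/measurable_funX.
apply: (@le_trans _ _ (\int[P]_w (((2 * c)^-1)%:E * (X w ^+ 2)%:E + (c / 2)%:E))%E).
  apply: ge0_le_integral => //.
  - by move=> w _; rewrite lee_fin.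
  - exact/measurable_EFinP.
  - by apply: emeasurable_funD => //; apply: measurable_funeM.
  - move=> w _; rewrite -EFinM -EFinD lee_fin; move: (X w) => n.
    have -> : (2 * c)^-1 * n ^+ 2 + c / 2 = n + (n - c) ^+ 2 / (2 * c).
      by field; rewrite gt_eqF.
    by rewrite lerDl divr_ge0 ?sqr_ge0// mulr_ge0// ltW.
rewrite ge0_integralD//; last 3 first.
- by move=> w _; rewrite -EFinM lee_fin mulr_ge0 ?sqr_ge0.
- exact: measurable_funeM.
- by move=> w _; rewrite lee_fin divr_ge0// ltW.
rewrite integral_cst//= probability_setT mule1 ge0_integralZl//; last first.
  by move=> w _; rewrite lee_fin sqr_ge0.
apply: (@le_trans _ _ (((2 * c)^-1)%:E * (v ^+ 2)%:E + (c / 2)%:E)%E).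
  by apply: leeD; [apply: lee_wpmul2l; rewrite ?lee_fin|].
rewrite -EFinM -!EFinD lee_fin -/c [leRHS](@splitr R c) lerD2r.
rewrite invfM -mulrA [leRHS]mulrC ler_pM2l ?invr_gt0//.
rewrite ler_pdivrMl// -expr2 ler_pXn2r ?nnegrE ?(ltW c0)//.
by rewrite lerDl ltW.
Qed.

Section expectations.
Context {R : realType} {d : nat} (dO dX : measure_display).
Context (Omega : measurableType dO) (Xi : measurableType dX).
Variables (P : probability Omega R) (xi : {RV P >-> Xi}).
Variables (xis : nat -> {RV P >-> Xi}).
Variables (G : 'rV[R]_d -> Xi -> 'rV[R]_d) (F : 'rV[R]_d -> R) (sigma L1 : R).
Variable x1 : 'rV[R]_d.
Hypothesis xis_indep : mutually_independent [set t | (1 <= t)%N] xis.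
Hypothesis xis_law : forall t, (1 <= t)%N -> same_law (xis t) xi.
Hypotheses (mG : measurable_oracle G) (unbG : unbiased_oracle xi G F).
Hypothesis (varG : bounded_variance_oracle xi G F sigma).
Hypothesis sigma_ge0 : 0 <= sigma.

Local Notation S := (d.-tuple R * d.-tuple R * d.-tuple R)%type.
Local Notation state w := (nsgdm_state G (stepsize L1) decay x1 (fun s => xis s w)).
Local Notation x w := (nsgdm G (stepsize L1) decay x1 (fun s => xis s w)).
Local Notation N w := (noise_average L1 F G x1 (fun s => xis s w)).

(** The averaged noise is carried along in the state, next to the iterate and
    the momentum, so that it is also a function of the chain. *)
Definition nsgdm_transition (t : nat) (p : S * Xi) : S :=
  let y := row_of_tuple p.1.1.1 in
  let m := decay t *: row_of_tuple p.1.1.2 + (1 - decay t) *: G y p.2 in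
  (tuple_of_row (y - (stepsize L1 t / enorm m) *: m), tuple_of_row m,
   tuple_of_row (decay t *: row_of_tuple p.1.2 + (1 - decay t) *: (G y p.2 - grad F y))).

Lemma measurable_nsgdm_transition t : measurable_fun setT (nsgdm_transition t).
Proof.
have my : measurable_row (fun p : S * Xi => row_of_tuple p.1.1.1).
  apply: measurable_row_of_tuple; apply: measurableT_comp => //.
  exact: measurableT_comp.
have mm : measurable_row (fun p : S * Xi => row_of_tuple p.1.1.2).
  apply: measurable_row_of_tuple; apply: measurableT_comp => //.
  exact: measurableT_comp.
have mn : measurable_row (fun p : S * Xi => row_of_tuple p.1.2).
  by apply: measurable_row_of_tuple; apply: measurableT_comp.
have mGp : measurable_row (fun p : S * Xi => G (row_of_tuple p.1.1.1) p.2).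
  exact: measurable_row_oracle.
have mm' : measurable_row (fun p : S * Xi =>
    decay t *: row_of_tuple p.1.1.2 + (1 - decay t) *: G (row_of_tuple p.1.1.1) p.2).
  by apply: measurable_rowD; apply: measurable_rowZ.
apply: measurable_fun_pair; last first.
  apply: measurable_tuple_of_row; apply: measurable_rowD; apply: measurable_rowZ => //.
  by apply: measurable_rowB => //; exact: (measurable_row_grad mG unbG).
apply: measurable_fun_pair; last exact: measurable_tuple_of_row.
apply: measurable_tuple_of_row; apply: measurable_rowB => //.
apply: measurable_rowZ => //; apply: measurable_funM => //.
rewrite (_ : (fun p => _) = (fun p : S * Xi => enorm (decay t *: row_of_tuple p.1.1.2
    + (1 - decay t) *: G (row_of_tuple p.1.1.1) p.2) `^ (-1))); last first.
  by apply/funext => p; rewrite powR_inv1// enorm_ge0.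
apply: (@measurableT_comp _ _ _ _ _ _ (@powR R ^~ (-1))) => //.
exact: measurable_enorm.
Qed.

Local Notation Y := (chain nsgdm_transition
  (tuple_of_row x1, tuple_of_row 0, tuple_of_row 0)).

Lemma nsgdm_chainE (z : nat -> Xi) t :
  let s := nsgdm_state G (stepsize L1) decay x1 z t in
  Y z t = (tuple_of_row s.1, tuple_of_row s.2, tuple_of_row (noise_average L1 F G x1 z t)).
Proof.
elim: t => [//|t IH]; rewrite /= IH /nsgdm_transition /= !tuple_of_rowK.
by rewrite /nsgdm/=; case: (nsgdm_state _ _ _ _ _ t).
Qed.

Let measurable_Y t : measurable_fun setT (fun w => Y (fun s => xis s w) t).
Proof. by apply: measurable_chain; exact: measurable_nsgdm_transition. Qed.

Lemma measurable_iterate t : measurable_row (fun w => x w t.+1).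
Proof.
rewrite (_ : (fun w => _) = (fun w => row_of_tuple (Y (fun s => xis s w) t).1.1)).
  apply: measurable_row_of_tuple.
  by do 2! (apply: measurableT_comp => //).
by apply/funext => w; rewrite nsgdm_chainE/= tuple_of_rowK.
Qed.

Lemma measurable_noise t : measurable_row (fun w => N w t).
Proof.
rewrite (_ : (fun w => _) = (fun w => row_of_tuple (Y (fun s => xis s w) t).2)).
  by apply: measurable_row_of_tuple; apply: measurableT_comp.
by apply/funext => w; rewrite nsgdm_chainE/= tuple_of_rowK.
Qed.

Lemma measurable_noise_sqr t :
  measurable_fun setT (fun w => (enorm (N w t) ^+ 2)%:E).
Proof.
by apply/measurable_EFinP/measurable_funX/measurable_enorm; exact: measurable_noise.
Qed.

(** By [integral_chain] the state before the step may be considered fixed, and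
    [second_moment_step] applies to it. *)
Lemma noise_moment_step t :
  (\int[P]_w (enorm (N w t.+1) ^+ 2)%:E <=
   (decay t.+1 ^+ 2)%:E * \int[P]_w (enorm (N w t) ^+ 2)%:E
   + ((1 - decay t.+1) ^+ 2 * sigma ^+ 2)%:E)%E.
Proof.
pose f (p : S * Xi) : \bar R := (enorm (decay t.+1 *: row_of_tuple p.1.2 +
  (1 - decay t.+1) *: (G (row_of_tuple p.1.1.1) p.2 - grad F (row_of_tuple p.1.1.1))) ^+ 2)%:E.
have mf : measurable_fun [set: S * Xi] f.
  apply/measurable_EFinP/measurable_funX/measurable_enorm.
  have my : measurable_row (fun p : S * Xi => row_of_tuple p.1.1.1).
    apply: measurable_row_of_tuple; apply: measurableT_comp => //.
    exact: measurableT_comp.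
  have mn : measurable_row (fun p : S * Xi => row_of_tuple p.1.2).
    by apply: measurable_row_of_tuple; apply: measurableT_comp.
  apply: measurable_rowD; apply: measurable_rowZ => //.
  apply: measurable_rowB; first exact: measurable_row_oracle.
  exact: (measurable_row_grad mG unbG).
have f0 p : (0 <= f p)%E by rewrite lee_fin sqr_ge0.
have -> : (\int[P]_w (enorm (N w t.+1) ^+ 2)%:E =
    \int[P]_w f (Y (fun s => xis s w) t, xis t.+1 w))%E.
  apply: eq_integral => w _; rewrite /f nsgdm_chainE/= !tuple_of_rowK.
  by [].
rewrite (integral_chain xis_indep xis_law _ measurable_nsgdm_transition)//.
have mN := measurable_noise_sqr t.
rewrite -[X in (_ + X)%E]mule1 -(probability_setT P) -integral_cst//.
rewrite -ge0_integralZl//; last 2 first.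
- by move=> w _; rewrite lee_fin sqr_ge0.
- by rewrite lee_fin sqr_ge0.
rewrite -ge0_integralD//; last 3 first.
- by move=> w _; rewrite -EFinM lee_fin mulr_ge0 ?sqr_ge0.
- by apply: measurable_funeM.
- by move=> w _; rewrite lee_fin mulr_ge0 ?sqr_ge0.
apply: ge0_le_integral => //.
- by move=> w _; apply: integral_ge0.
- pose g (p : S * Omega) := f (p.1, xi p.2).
  have mg : measurable_fun [set: S * Omega] g.
    apply: (measurableT_comp mf); apply: measurable_fun_pair => //.
    exact: measurableT_comp.
  have g0 p : (0 <= g p)%E by exact: f0.
  exact: (measurableT_comp (measurable_fun_fubini_tonelli_F (m2 := P) g mg g0)
    (measurable_Y t)).
- by apply: emeasurable_funD => //; apply: measurable_funeM.
- move=> w _; rewrite /f /= nsgdm_chainE/= !tuple_of_rowK -EFinM -EFinD.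
  exact: second_moment_step.
Qed.

Lemma noise_second_moment t :
  (\int[P]_w (enorm (N w t) ^+ 2)%:E <= (2 * inv_root4 t ^+ 2 * sigma ^+ 2)%:E)%E.
Proof.
elim: t => [|t IH].
  rewrite inv_root4_0 expr0n mulr0 mul0r.
  under eq_integral do rewrite /= enorm0 expr0n.
  by rewrite integral0.
apply: le_trans (noise_moment_step t) _.
apply: (@le_trans _ _ ((decay t.+1 ^+ 2)%:E * (2 * inv_root4 t ^+ 2 * sigma ^+ 2)%:E
   + ((1 - decay t.+1) ^+ 2 * sigma ^+ 2)%:E)%E).
  by rewrite leeD2r// lee_wpmul2l// lee_fin sqr_ge0.
rewrite -EFinM -EFinD lee_fin mulrA -mulrDl ler_wpM2r ?sqr_ge0//.
by rewrite /decay subKr; exact: noise_recursion_bound.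
Qed.

Lemma noise_first_moment t :
  (\int[P]_w (enorm (N w t))%:E <= (2 * inv_root4 t * sigma)%:E)%E.
Proof.
have qs : 0 <= inv_root4 t * sigma by rewrite mulr_ge0 ?inv_root4_ge0.
apply: expectation_le_sqrt_moment.
- exact/measurable_enorm/measurable_noise.
- by move=> w; exact: enorm_ge0.
- by rewrite -mulrA mulr_ge0.
apply: le_trans (noise_second_moment t) _; rewrite lee_fin.
have := sqr_ge0 (inv_root4 t * sigma); nra.
Qed.

End expectations.

(** * The convergence rate *)

(** Each term [1 / (t + 1)] is at most [ln (t + 1) - ln t], by [ln x <= x - 1] at
    [x = t / (t + 1)]. *)
Lemma harmonic_le_ln {R : realType} (T : nat) :
  \sum_(1 <= t < T.+2) t%:R^-1 <= 1 + ln T.+1%:R :> R.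
Proof.
elim: T => [|T IH]; first by rewrite big_nat1 invr1 ln1 addr0.
rewrite big_nat_recr//=.
have T1 : 0 < T.+1%:R :> R by rewrite ltr0n.
have T2 : 0 < T.+2%:R :> R by rewrite ltr0n.
have T0 : 0 <= T%:R :> R by [].
have TS : T.+2%:R = T.+1%:R + 1 :> R by rewrite -natr1.
have : ln (1 - T.+2%:R^-1) <= - T.+2%:R^-1 :> R.
  by apply: le_ln1Dx; rewrite ltrN2 invf_lt1// ltr1n.
have -> : 1 - T.+2%:R^-1 = T.+1%:R / T.+2%:R :> R.
  by rewrite TS; field; rewrite gt_eqF//; lra.
rewrite ln_div ?posrE// lerBlDr => h; apply: le_trans (lerD IH (lexx _)) _.
move: h; move: (ln _) (ln _) (_^-1) => a b c; lra.
Qed.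

Section rate.
Context {R : realType} {d : nat} (dO dX : measure_display).
Context (Omega : measurableType dO) (Xi : measurableType dX).
Variables (P : probability Omega R) (xi : {RV P >-> Xi}).
Variables (xis : nat -> {RV P >-> Xi}).
Variables (G : 'rV[R]_d -> Xi -> 'rV[R]_d) (F : 'rV[R]_d -> R).
Variables (Fstar L0 L1 sigma : R) (x1 : 'rV[R]_d).
Hypotheses (L0_ge0 : 0 <= L0) (L1_gt0 : 0 < L1) (sigma_ge0 : 0 <= sigma).
Hypotheses (Fstar_le : forall x, Fstar <= F x) (smF : L0L1_smooth L0 L1 F).
Hypotheses (mG : measurable_oracle G) (unbG : unbiased_oracle xi G F).
Hypothesis (varG : bounded_variance_oracle xi G F sigma).
Hypothesis xis_indep : mutually_independent [set t | (1 <= t)%N] xis.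
Hypothesis xis_law : forall t, (1 <= t)%N -> same_law (xis t) xi.

Local Notation x w := (nsgdm G (stepsize L1) decay x1 (fun s => xis s w)).
Local Notation N w := (noise_average L1 F G x1 (fun s => xis s w)).
Let gamma t w : R := enorm (grad F (x w t)).

Let gamma_ge0 t w : 0 <= gamma t w. Proof. exact: enorm_ge0. Qed.

Let stepsize_nneg t : 0 <= stepsize L1 t. Proof. exact: stepsize_ge0. Qed.

Let measurable_gamma t : measurable_fun setT (gamma t).
Proof.
apply: measurable_enorm; apply: (measurable_row_grad mG unbG).
case: t => [|t]; last exact: (measurable_iterate xis L1 x1 mG unbG).
exact: (measurable_iterate xis L1 x1 mG unbG 0).
Qed.

Let measurable_N t : measurable_fun setT (fun w => enorm (N w t)).
Proof. exact/measurable_enorm/(measurable_noise xis L1 x1 mG unbG). Qed.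

Lemma weighted_gradient_bound T :
  (\sum_(1 <= t < T.+1) (stepsize L1 t)%:E * \int[P]_w (gamma t w)%:E <=
   (2 * (F x1 - Fstar) + (2 * sigma / (3 * L1) + L0 / (12 * L1 ^+ 2))
     * \sum_(1 <= t < T.+1) t%:R^-1)%:E)%E.
Proof.
have c0 t : 0 <= L0 / (12 * L1 ^+ 2) / t%:R.
  by rewrite divr_ge0// divr_ge0// mulr_ge0// sqr_ge0.
have D0 : 0 <= 2 * (F x1 - Fstar) by rewrite mulr_ge0// subr_ge0.
pose h t w : \bar R := ((4 * stepsize L1 t)%:E * (enorm (N w t))%:E
  + (L0 / (12 * L1 ^+ 2) / t%:R)%:E)%E.
have h0 t w : (0 <= h t w)%E.
  rewrite /h -EFinM -EFinD lee_fin; apply: addr_ge0 => //.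
  by rewrite mulr_ge0 ?enorm_ge0// mulr_ge0.
have mN t : measurable_fun setT (fun w => (4 * stepsize L1 t)%:E * (enorm (N w t))%:E)%E.
  by apply: measurable_funeM; exact/measurable_EFinP.
have mh t : measurable_fun setT (h t).
  by apply: emeasurable_funD.
have inth t : (\int[P]_w h t w <=
    ((2 * sigma / (3 * L1) + L0 / (12 * L1 ^+ 2)) / t%:R)%:E)%E.
  rewrite ge0_integralD//; last 2 first.
  - by move=> w _; rewrite -EFinM lee_fin mulr_ge0 ?enorm_ge0// mulr_ge0.
  - by move=> w _; rewrite lee_fin.
  rewrite integral_cst//= probability_setT mule1 ge0_integralZl//; last 3 first.
  - exact/measurable_EFinP.
  - by move=> w _; rewrite lee_fin enorm_ge0.
  - by rewrite lee_fin mulr_ge0.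
  apply: (@le_trans _ _ ((4 * stepsize L1 t)%:E * (2 * inv_root4 t * sigma)%:E
      + (L0 / (12 * L1 ^+ 2) / t%:R)%:E)%E).
    apply: leeD => //; apply: lee_wpmul2l; first by rewrite lee_fin mulr_ge0.
    exact: (noise_first_moment L1 x1 xis_indep xis_law mG unbG varG sigma_ge0).
  rewrite -EFinM -EFinD lee_fin [leRHS]mulrDl lerD2r -(inv_root4_exp4 t) /stepsize.
  by rewrite le_eqVlt; apply/orP; left; apply/eqP; field; rewrite gt_eqF.
have -> : (\sum_(1 <= t < T.+1) (stepsize L1 t)%:E * \int[P]_w (gamma t w)%:E =
    \int[P]_w (\sum_(1 <= t < T.+1) stepsize L1 t * gamma t w)%:E)%E.
  under [RHS]eq_integral do rewrite -sumEFin.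
  rewrite ge0_integral_sum//; last 2 first.
  - by move=> t; apply/measurable_EFinP; exact: measurable_funM.
  - by move=> t w _; rewrite lee_fin mulr_ge0.
  apply: eq_bigr => t _; under [RHS]eq_integral do rewrite EFinM.
  rewrite ge0_integralZl//; last by rewrite lee_fin.
    exact/measurable_EFinP.
  by move=> w _; rewrite lee_fin.
apply: (@le_trans _ _ (\int[P]_w ((2 * (F x1 - Fstar))%:E
    + \sum_(1 <= t < T.+1) h t w))%E).
  apply: ge0_le_integral => //.
  - by move=> w _; rewrite lee_fin sumr_ge0// => t _; rewrite mulr_ge0.
  - by apply/measurable_EFinP/measurable_sum => t; exact: measurable_funM.
  - by apply: emeasurable_funD => //; exact: emeasurable_sum.
  - move=> w _; rewrite /h; under [X in (_ <= _ + X)%E]eq_bigr do rewrite -EFinM -EFinD.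
    rewrite sumEFin -EFinD lee_fin.
    exact: (pathwise_bound L0_ge0 L1_gt0 smF G x1).
rewrite ge0_integralD//; last 2 first.
- by move=> w _; apply: sume_ge0.
- exact: emeasurable_sum.
rewrite integral_cst//= probability_setT mule1 ge0_integral_sum//.
rewrite EFinD leeD2l// mulr_sumr -sumEFin.
by apply: lee_sum => t _; exact: inth.
Qed.

(** The stepsizes decrease, and [1 / T] is [12 L1 T^(-1/4)] times the last one;
    the plain average is therefore dominated by the sum weighted with the
    stepsizes. *)
Lemma average_gradient_bound T : (1 <= T)%N ->
  ((T%:R^-1)%:E * \sum_(1 <= t < T.+1) \int[P]_w (gamma t w)%:E <=
   (24 * (1 + ln T%:R) *
     ((L1 * (F x1 - Fstar) + sigma + L0 / L1) * inv_root4 T))%:E)%E.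
Proof.
move=> T1.
have k0 : 0 <= 12 * L1 * inv_root4 T by rewrite !mulr_ge0 ?inv_root4_ge0// ltW.
have I0 t : (0 <= \int[P]_w (gamma t w)%:E)%E.
  by apply: integral_ge0 => w _; rewrite lee_fin.
have D0 : 0 <= F x1 - Fstar by rewrite subr_ge0.
apply: (@le_trans _ _ ((12 * L1 * inv_root4 T)%:E *
    \sum_(1 <= t < T.+1) (stepsize L1 t)%:E * \int[P]_w (gamma t w)%:E)%E).
  rewrite !ge0_sume_distrr//; last first.
    by move=> t _; rewrite mule_ge0// lee_fin.
  rewrite !big_seq; apply: lee_sum => t; rewrite mem_index_iota => /andP[t1 tT].
  rewrite muleA -EFinM; apply: lee_wpmul2r; first exact: I0.
  rewrite lee_fin -(inv_root4_exp4 T).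
  have -> : inv_root4 T ^+ 4 = 12 * L1 * inv_root4 T * stepsize L1 T.
    by rewrite /stepsize; field; rewrite gt_eqF.
  rewrite ler_wpM2l// /stepsize ler_pM2r ?invr_gt0 ?mulr_gt0//.
  by rewrite ler_pXn2r// ?nnegrE ?inv_root4_ge0// le_inv_root4.
apply: (le_trans (lee_wpmul2l _ (weighted_gradient_bound T))) => //.
rewrite -EFinM lee_fin.
have : \sum_(1 <= t < T.+1) t%:R^-1 <= 1 + ln T%:R :> R.
  by case: T T1 {k0} => // T _; exact: harmonic_le_ln.
have : 0 <= ln T%:R :> R by rewrite ln_ge0// ler1n.
move: (ln _) (\sum_(_ <= _ < _) _) => l H l0 Hl.
have -> : 12 * L1 * inv_root4 T * (2 * (F x1 - Fstar) +
    (2 * sigma / (3 * L1) + L0 / (12 * L1 ^+ 2)) * H) =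
    (24 * (L1 * (F x1 - Fstar)) + (8 * sigma + L0 / L1) * H) * inv_root4 T.
  by field; rewrite gt_eqF.
rewrite [leRHS]mulrA ler_wpM2r ?inv_root4_ge0//.
have a0 : 0 <= L1 * (F x1 - Fstar) by rewrite mulr_ge0// ltW.
have b0 : 0 <= L0 / L1 by rewrite divr_ge0// ltW.
have c0 : 0 <= 8 * sigma + L0 / L1 by rewrite addr_ge0// mulr_ge0.
apply: le_trans (_ : (24 * (L1 * (F x1 - Fstar)) + (8 * sigma + L0 / L1) * (1 + l)) <= _).
  by rewrite lerD2l ler_wpM2l.
have arith (s a b : R) : 0 <= s -> 0 <= a -> 0 <= b ->
  24 * a + (8 * s + b) * (1 + l) <= 24 * (1 + l) * (a + s + b).
  by nra.
exact: arith.
Qed.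

End rate.


Theorem corollary3 (R : realType) :
  exists C k : R, 0 < C /\ 0 < k /\
  forall (d : nat) (F : 'rV[R]_d -> R) (Fstar L0 L1 sigma : R)
    (dO dX : measure_display) (Omega : measurableType dO)
    (Xi : measurableType dX) (P : probability Omega R)
    (xi : {RV P >-> Xi}) (xis : nat -> {RV P >-> Xi})
    (G : 'rV[R]_d -> Xi -> 'rV[R]_d) (x1 : 'rV[R]_d),
  (1 <= d)%N ->
  0 <= L0 -> 0 < L1 -> 0 <= sigma ->
  (forall x, Fstar <= F x) ->
  L0L1_smooth L0 L1 F ->
  measurable_oracle G ->
  unbiased_oracle xi G F ->
  bounded_variance_oracle xi G F sigma ->
  mutually_independent [set t | (1 <= t)%N] xis ->
  (forall t, (1 <= t)%N -> same_law (xis t) xi) ->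
  let beta (t : nat) : R := 1 - t%:R `^ (- (1 / 2)) in
  let eta (t : nat) : R := t%:R `^ (- (3 / 4)) / (12 * L1) in
  let x (t : nat) (w : Omega) := nsgdm G eta beta x1 (fun s => xis s w) t in
  let Delta1 := F x1 - Fstar in
  forall T : nat, (1 <= T)%N ->
  ((T%:R^-1)%:E * \sum_(1 <= t < T.+1) 'E_P[fun w : Omega => enorm (grad F (x t w))]
   <= (C * (1 + ln T%:R) `^ k
       * ((L1 * Delta1 + sigma + L0 / L1) / T%:R `^ (1 / 4)))%R%:E)%E.
Proof.
exists 24, 1; do 2 split => //.
move=> d F Fstar L0 L1 sigma dO dX Omega Xi P xi xis G x1 _ L0_ge0 L1_gt0
  sigma_ge0 Fstar_le smF mG unbG varG xis_indep xis_law b e x Delta1 T T1.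
have bE : b = decay.
  apply/funext => t; rewrite /b /decay inv_root4X; congr (1 - _ `^ _); lra.
have eE : e = stepsize L1 by apply/funext => t; rewrite /e /stepsize inv_root4X.
have lT : 0 <= ln T%:R :> R by rewrite ln_ge0// ler1n.
rewrite powRr1 ?addr_ge0// -powRN.
under eq_bigr do rewrite unlock.
rewrite /x bE eE.
exact: (average_gradient_bound x1 L0_ge0 L1_gt0 sigma_ge0 Fstar_le smF mG unbG varG
  xis_indep xis_law T1).
Qed.
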